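(* Let $S$ be an orthodox semigroup (not necessarily finite). Then $S$ has a permutation matching if and only if $|V(V(a))|=|V(a)|$ for all $a\in S$. Moreover, if $S$ has a permutation matching, then $S$ possesses an involution matching.
   Context: For an element $a$ of a semigroup $S$, $V(a)=\{b\in S: aba=a,\ bab=b\}$ is the set of inverses of $a$; for $A\subseteq S$, $V(A)=\bigcup_{a\in A}V(a)$. $S$ is regular if $V(a)\neq\emptyset$ for every $a\in S$. $S$ is orthodox if it is regular and its set of idempotents $E(S)$ is a subsemigroup of $S$. A permutation matching of a regular semigroup $S$ is a permutation (bijection) $f:S\to S$ such that $f(a)\in V(a)$ for all $a\in S$; an involution matching is a permutation matching $f$ with $f^2$ equal to the identity mapping (the identity mapping itself is allowed). $|X|$ denotes the cardinality of $X$. *)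

(* Defs.v *)
From mathcomp Require Export all_boot.
From mathcomp Require Export boolp classical_sets functions cardinality.

Set Implicit Arguments.
Unset Strict Implicit.
Unset Printing Implicit Defensive.

Local Open Scope classical_set_scope.
Local Open Scope group_scope.

Definition inverses (S : semigroupType) (a : S) : set S :=
  [set b | a * b * a = a /\ b * a * b = b].

Definition inverses_of (S : semigroupType) (A : set S) : set S :=
  \bigcup_(a in A) inverses a.

Definition regular_semigroup (S : semigroupType) : Prop :=
  forall a : S, inverses a !=set0.

Definition idempotents (S : semigroupType) : set S := [set e | e * e = e].
Arguments idempotents S : clear implicits.

Definition orthodox (S : semigroupType) : Prop :=
  regular_semigroup S /\
  (forall e f : S, idempotents S e -> idempotents S f ->
     idempotents S (e * f)).

Definition permutation_matching (S : semigroupType) (f : S -> S) : Prop :=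
  bijective f /\ (forall a : S, inverses a (f a)).

Definition involution_matching (S : semigroupType) (f : S -> S) : Prop :=
  permutation_matching f /\ involutive f.

(* Main.v *)
(** In an orthodox semigroup two elements sharing an inverse have the same
    inverses, so the sets V(a) partition S, V(V(a)) is the block of a, and V is
    an involution on the blocks.  A permutation matching injects each block into
    its partner and conversely, so Cantor-Bernstein gives equipotence.
    Conversely, an involution matching is assembled from bijections between the
    two blocks of each pair, and from the identity on self-paired blocks. *)
Require Import Defs.

Set Implicit Arguments.
Unset Strict Implicit.
Unset Printing Implicit Defensive.

Local Open Scope card_scope.
Local Open Scope classical_set_scope.
Local Open Scope group_scope.

Lemma inverses_sym (S : semigroupType) (a b : S) : inverses a b -> inverses b a.
Proof. by case. Qed.

(* In a band, p R g L h puts p and h in one D-class, which is a rectangular band. *)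
Lemma rectangular_idempotents (S : semigroupType) (p g h : S) :
  p * g = g -> g * p = p -> g * h = g -> h * g = h -> idempotents S (h * p) ->
  p * h * p = p /\ h * p * h = h.
Proof.
move=> pg gp gh hg hp; split.
  have {3}-> : p = g * (h * p) by rewrite mulgA gh gp.
  by rewrite -hp !mulgA gh gp.
have hE : h * p * g = h by rewrite -mulgA pg hg.
by rewrite -{2}hE mulgA hp.
Qed.

Lemma idempotent_mul_inverse (S : semigroupType) (a b : S) :
  inverses a b -> idempotents S (a * b).
Proof. by case=> aba _; rewrite /idempotents/= mulgA aba. Qed.

(** The idempotents [a * y] and [b * x] are linked through [a * x], and [x * b] and [y * a] through
    [x * a]. Orthodoxy keeps their products idempotent, so each pair is mutually inverse. *)
Lemma inverses_shared_sub (S : semigroupType) (hS : orthodox S) (x a b y : S) :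
  inverses a x -> inverses b x -> inverses a y -> inverses b y.
Proof.
case: hS => _ hE ax bx ay.
have [axa xax] := ax; have [bxb xbx] := bx; have [aya yay] := ay.
have [php hph] : (a * y) * (b * x) * (a * y) = a * y /\
                 (b * x) * (a * y) * (b * x) = b * x.
  apply: (@rectangular_idempotents _ _ (a * x)).
  - by rewrite mulgA aya.
  - by rewrite mulgA axa.
  - by rewrite -mulgA (mulgA x) xbx.
  - by rewrite -mulgA (mulgA x) xax.
  - by apply: hE; apply: idempotent_mul_inverse.
have [fqf qfq] : (x * b) * (y * a) * (x * b) = x * b /\
                 (y * a) * (x * b) * (y * a) = y * a.
  apply: (@rectangular_idempotents _ _ (x * a)).
  - by rewrite mulgA xbx.
  - by rewrite mulgA xax.
  - by rewrite -mulgA (mulgA a) aya.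
  - by rewrite -mulgA (mulgA a) axa.
  - by apply: hE; apply: idempotent_mul_inverse; apply: inverses_sym.
move: php hph fqf qfq.
set p := a * y; set h := b * x; set f := x * b; set q := y * a.
move=> php hph fqf qfq.
have bE : b = h * a * f.
  by rewrite /h /f -!mulgA (mulgA x a) (mulgA (x * a)) xax mulgA bxb.
have yE : y = q * x * p.
  by rewrite /p /q -!mulgA (mulgA a x) (mulgA (a * x)) axa mulgA yay.
have xE : x = f * x * h by rewrite /f /h xbx mulgA xbx.
have aE : a = p * a * q by rewrite /p /q aya mulgA aya.
have bf : b * f = b by rewrite /f mulgA.
have qy : q * y = y by [].
have yp : y * p = y by rewrite /p mulgA.
split.
  (* Writing [y] as [q * x * p] and then [x] as [f * x * h] encloses [q] between two copies of [f]
     and [p] between two copies of [h], so both are absorbed. *)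
  rewrite -{1}bf -{2}bxb -/h yE xE.
  transitivity (b * (f * q * f) * x * (h * p * h) * b); first by rewrite !mulgA.
  by rewrite fqf hph bf -mulgA bxb.
rewrite -{1}yp -{2}qy bE aE.
transitivity (y * (p * h * p) * a * (q * f * q) * y); first by rewrite !mulgA.
by rewrite php qfq yp -mulgA qy.
Qed.

Lemma inverses_shared (S : semigroupType) (hS : orthodox S) (x a b : S) :
  inverses a x -> inverses b x -> inverses a = inverses b.
Proof.
move=> ax bx; apply/seteqP; split=> y.
  exact: (inverses_shared_sub hS ax bx).
exact: (inverses_shared_sub hS bx ax).
Qed.

Lemma inverses_of_inverses (S : semigroupType) (hS : orthodox S) (a b : S) :
  inverses a b -> inverses_of (inverses a) = inverses b.
Proof.
move=> ab; apply/seteqP; split=> [c [d ad dc]|c bc]; last by exists b.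
have := inverses_shared hS (inverses_sym ab) (inverses_sym ad).
by move=> ->.
Qed.

Lemma card_le_homo (T U : Type) (f : T -> U) (A : set T) (B : set U) :
  injective f -> {homo f : x / A x >-> B x} -> A #<= B.
Proof.
move=> finj fAB; apply: (@card_le_trans _ _ _ (f @` A)).
  have : A #= f @` A by rewrite card_eq_sym inj_card_eq// => x y _ _; apply: finj.
  by rewrite card_eq_le => /andP[].
by apply: subset_card_le => _ [x Ax <-]; apply: fAB.
Qed.

(** Disjointness lets a bijection from [A] to [B] be glued to its inverse. *)
Lemma card_eq_swap (T : Type) (A B : set T) :
  A #= B -> A `&` B = set0 ->
  exists f : T -> T, [/\ {homo f : x / A x >-> B x}, {homo f : x / B x >-> A x}
    & forall x, (A `|` B) x -> f (f x) = x].
Proof.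
(* The partial inverse takes [point] as default value; over an empty type everything is vacuous. *)
elim/Ppointed: T => T in A B *; first by exists id; split=> x; case: (no x).
case/card_set_bijP => g gAB AB0; have [gA ginj _] := gAB.
have gBA := bijpinv_bij (fun=> point) gAB.
set k := 'pinv_(fun=> point) A g in gBA; have [kB _ _] := gBA.
have BnA x : B x -> ~ A x by move=> Bx Ax; have : (A `&` B) x by []; rewrite AB0.
exists (fun x => if `[< A x >] then g x else k x); split=> x.
- by move=> Ax; rewrite asboolT//; apply: gA.
- by move=> /[dup] Bx /BnA nAx; rewrite asboolF//; apply: kB.
case=> [Ax|Bx].
  rewrite (asboolT Ax) asboolF; last exact/BnA/gA.
  by apply: (pinvKV _ ginj); rewrite inE.
rewrite (asboolF (BnA _ Bx)) asboolT; last exact: kB.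
have [_ _ gsurj] := gAB.
by apply: (surjpK _ gsurj); rewrite inE.
Qed.

Lemma local_involution_matching (S : semigroupType) (hS : orthodox S) (a : S) :
  inverses_of (inverses a) #= inverses a ->
  exists f : S -> S, forall b,
    (inverses_of (inverses a) `|` inverses a) b ->
    inverses b (f b) /\ f (f b) = b.
Proof.
move=> aE; case: (hS) => /(_ a)[c ac] _.
rewrite (inverses_of_inverses hS ac) in aE *.
(* Any element of one block is inverse to any element of the partner block. *)
have sub b d : inverses c b -> inverses a d -> inverses b d.
  move=> cb ad; rewrite -(inverses_shared hS ac) //; exact: inverses_sym.
(* Blocks that meet coincide, and then every element is its own inverse. *)
have [[d [cd ad]]|dis] := pselect (inverses c `&` inverses a !=set0).
  exists id => b cab; split=> //.
  have ca := inverses_shared hS cd ad.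
  by rewrite ca setUid in cab; apply: sub; rewrite ?ca.
have dis0 : inverses c `&` inverses a = set0.
  by apply: contrapT => /eqP/set0P.
have [f [fca fac ff]] := card_eq_swap aE dis0.
exists f => b cab; split; last exact: ff.
case: cab => [cb|ab]; first by apply: sub => //; apply: fca.
by apply/inverses_sym/sub => //; apply: fac.
Qed.

Theorem theorem3p1 (S : semigroupType) (hS : orthodox S) :
  ((exists f : S -> S, permutation_matching f) <->
   (forall a : S, inverses_of (inverses a) #= inverses a)) /\
  ((exists f : S -> S, permutation_matching f) ->
   exists f : S -> S, involution_matching f).
Proof.
have card_of_matching : (exists f : S -> S, permutation_matching f) ->
    forall a : S, inverses_of (inverses a) #= inverses a.
  move=> [f [/bij_inj finj fV]] a.
  apply: Cantor_Bernstein; apply: (card_le_homo finj) => y; last by exists y.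
  (* Here [y] and [a] share the inverse [x], so [f y] lies in V(a). *)
  case=> x ax xy; have := fV y.
  by rewrite (inverses_shared hS (inverses_sym xy) ax).
have matching_of_card : (forall a : S, inverses_of (inverses a) #= inverses a) ->
    exists f : S -> S, involution_matching f.
  move=> cardE.
  (* The sets [T a], each a block joined with its partner, are the classes on which the local
     involutions act. *)
  pose T (a : S) := inverses_of (inverses a) `|` inverses a.
  have Taa a : T a a.
    case: (hS) => /(_ a)[c ac] _; left; exists c => //; exact: inverses_sym.
  have TV a b : inverses a b -> T b = T a.
    move=> ab; rewrite /T (inverses_of_inverses hS ab).
    by rewrite (inverses_of_inverses hS (inverses_sym ab)) setUC.
  have Teq a b : T a b -> T b = T a.
    by case=> [[c /TV <- /TV]|/TV].
  have [F FV] := choice (fun a => local_involution_matching hS (cardE a)).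
  (* [F a] may vary with [a] inside a class, so one representative per class fixes which involution
     is used there. *)
  pose r a := xget a (T a).
  have Tr a : T a (r a) by apply: xgetPex; exists a.
  have req a b : T b = T a -> r b = r a.
    (* [xget] ignores its default value on a nonempty set. *)
    move=> ba; rewrite /r ba /xget; case: pselect => // -[].
    by exists a; apply/asboolP.
  have FVr a : inverses a (F (r a) a) /\ F (r a) (F (r a) a) = a.
    by apply: FV; rewrite -/(T _) (Teq _ _ (Tr a)).
  exists (fun a => F (r a) a).
  have Finv : involutive (fun a => F (r a) a).
    (* The image of [a] is an inverse of [a], so it has the same representative and the same local
       involution is applied twice. *)
    by move=> a /=; have [/TV/req -> ->] := FVr a.
  split=> //; split; first exact: inv_bij.
  by move=> a; case: (FVr a).
split; last by move=> /card_of_matching/matching_of_card.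
by split=> // /matching_of_card[f [fm _]]; exists f.
Qed.
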